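(* Let $\Omega\subset\mathbb{R}^d$ be a bounded domain. Let $S=\{z_1,\dots,z_m\}\subset\Omega\cup\partial\Omega$ be the finite set of collocation and boundary sample points used by an unprojected automatic-differentiation PINN loss. Assume the sampled loss depends only on finitely many values of $u$ and its derivatives up to finite order at points of $S$. Fix an interior point $x_0\in\Omega\setminus S$. Then there exists $\varphi\in C_c^\infty(\Omega)$ such that $$\varphi(x_0)=1,\qquad D^\alpha\varphi(z_j)=0\quad\text{for every sample point } z_j \text{ and every derivative } D^\alpha \text{ used by the loss}.$$ Consequently, for every candidate field $u$ and every $\beta\in\mathbb{R}$, the sampled loss takes the same value at $u$ and $u+\beta\varphi$, while $$(u+\beta\varphi)(x_0)=u(x_0)+\beta.$$ Hence finitely many collocation residual samples alone cannot yield a deterministic certificate for the unsampled point value at $x_0$.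
   Context: A physics-informed neural network (PINN) is a trainable field $u$ on $\overline\Omega$ fitted to a boundary-value problem $\mathcal{L}(u^\star)=f$ in $\Omega$, $\mathcal{B}(u^\star)=g$ on $\partial\Omega$, with exact solution $u^\star$. Its sampled loss is a function of the candidate field $u$ built from PDE residuals and boundary terms evaluated, by automatic differentiation of $u$, at the finitely many points of $S$. ''Unprojected'' means that the field is used directly, without being mapped to a finite-dimensional numerical (e.g. finite-element) space. Candidate fields are functions on $\overline\Omega$ for which the sampled values and derivatives are defined. The derivatives $D^\alpha$ used by the loss include order zero, i.e. sampled values of $u$ itself, and elements of $C_c^\infty(\Omega)$ are extended by zero to $\overline\Omega$. The perturbation $u+\beta\varphi$ is considered at the level of the underlying smooth problem; it need not be representable by a given PINN architecture. A deterministic certificate for the value at a point $x$ is an interval $I\subset\mathbb{R}$ guaranteed to satisfy $u^\star(x)\in I$. *)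

(* Defs.v *)
From mathcomp Require Import all_boot all_order all_algebra.
From mathcomp Require Import all_classical all_reals all_analysis.

Set Implicit Arguments.
Unset Strict Implicit.
Unset Printing Implicit Defensive.

Import Order.TTheory GRing.Theory Num.Theory.
Import numFieldNormedType.Exports.

Local Open Scope classical_set_scope.
Local Open Scope ring_scope.

(* A field on the closure of Omega is represented by a total function on R^d.
   All the notions below that involve Omega (values at points of the closure,
   derivatives inside Omega, limits from inside Omega at boundary points) only
   depend on the restriction of that function to the closure of Omega. *)
Notation scalar_field R d := ('rV[R]_d -> R).

Definition multiindex (d : nat) := {ffun 'I_d -> nat}.

Section Defs.
Context {R : realType} {d : nat}.
Implicit Types (Omega : set 'rV[R]_d) (u v phi : scalar_field R d) (x z : 'rV[R]_d).
Implicit Types (w : seq 'I_d) (alpha : multiindex d).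

Definition bounded_domain Omega : Prop :=
  [/\ open Omega, connected Omega, Omega !=set0 & bounded_set Omega].

(* Iterated partial derivatives along a word of coordinate directions, the head
   of the word being the outermost derivative. The value of [pderiv w u x] is
   meaningful only when [pderivable w u x]. *)
Definition pderiv w u : scalar_field R d :=
  foldr (fun i g x => 'D_(delta_mx ord0 i) g x) u w.

Fixpoint pderivable w u x : Prop :=
  if w is i :: w' then
    (\forall y \near x, pderivable w' u y) /\
    derivable (pderiv w' u) x (delta_mx ord0 i)
  else True.

Definition mzero : multiindex d := [ffun=> 0%N].

(* D^alpha = d_0^(alpha_0) ... d_(d-1)^(alpha_(d-1)) *)
Definition mword alpha : seq 'I_d :=
  flatten [seq nseq (alpha i) i | i <- enum 'I_d].

(* D^alpha u at a point z of the closure of Omega: the value u z in order zero,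
   the classical derivative at interior points, and at boundary points the
   limit of the interior derivatives (the continuous extension used to define
   C^k of the closure). *)
Definition Dsample Omega alpha u z : R :=
  if (alpha == mzero) || (z \in Omega) then pderiv (mword alpha) u z
  else lim (pderiv (mword alpha) u @ within Omega (nbhs z)).

Definition Dsample_defined Omega alpha u z : Prop :=
  if (alpha == mzero) || (z \in Omega) then pderivable (mword alpha) u z
  else (\forall y \near within Omega (nbhs z), pderivable (mword alpha) u y) /\
       cvg (pderiv (mword alpha) u @ within Omega (nbhs z)).

(* Elements of C_c^infty(Omega), already extended by zero. *)
Definition Cc_infty Omega phi : Prop :=
  [/\ forall w x, pderivable w phi x,
      forall w, continuous (pderiv w phi),
      compact (closure [set x | phi x != 0]) &
      closure [set x | phi x != 0] `<=` Omega].

Section Samples.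
Context {m : nat} (Omega : set 'rV[R]_d) (z : 'I_m -> 'rV[R]_d).

(* The pairs (j, alpha) in q are the evaluations D^alpha u (z j) performed, in
   addition to the sampled values u (z j), which are always available. *)
Variable q : seq ('I_m * multiindex d).

Definition sampled (j : 'I_m) alpha : Prop := alpha = mzero \/ (j, alpha) \in q.

Definition used alpha : Prop := exists j : 'I_m, sampled j alpha.

Definition candidate u : Prop :=
  forall j alpha, sampled j alpha -> Dsample_defined Omega alpha u (z j).

Definition same_samples u v : Prop :=
  forall j alpha, sampled j alpha ->
    Dsample Omega alpha u (z j) = Dsample Omega alpha v (z j).

Definition depends_only_on_samples (T : Type) (F : scalar_field R d -> T) : Prop :=
  forall u v, candidate u -> candidate v -> same_samples u v -> F u = F v.

End Samples.

(* I is guaranteed to contain the value at x of the exact solution, when all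
   that is known about the latter is that it belongs to K. *)
Definition certificate (K : set (scalar_field R d)) x (I : interval R) : Prop :=
  forall v, K v -> v x \in I.

End Defs.

(* Main.v *)
Require Import Defs.
From mathcomp Require Import all_boot all_order all_algebra.
From mathcomp Require Import all_classical all_reals all_analysis.
From mathcomp Require Import ring lra.
Import Order.TTheory GRing.Theory Num.Theory.
Import numFieldNormedType.Exports.
Local Open Scope classical_set_scope.
Local Open Scope ring_scope.

(* With the flat functions g_n(t) = t^(-n) exp(-1/t) for t > 0, extended by 0,
   which satisfy g_n' = g_(n+2) - n g_(n+1), the tensor product of the factors
   g_0(r - (x_i - x0_i)) g_0(r + (x_i - x0_i)) is a smooth bump supported in the
   closed sup-norm ball of radius r around x0. For r small this ball lies in
   Omega and misses every sample point, so adding a multiple of the bump does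
   not change the field near the samples, hence no sampled derivative, while
   the value at x0 can be made arbitrary. *)

(** * Flat exponential functions on the line *)

Section FlatExp.
Context {R : realType}.
Implicit Types (n : nat) (t x : R).

Definition flat_exp n t : R :=
  if 0 < t then t^-1 ^+ n * expR (- t^-1) else 0.

Lemma flat_exp_le0 n t : t <= 0 -> flat_exp n t = 0.
Proof. by move=> t0; rewrite /flat_exp ltNge t0. Qed.

Lemma flat_exp_gt0E n t : 0 < t -> flat_exp n t = t^-1 ^+ n * expR (- t^-1).
Proof. by rewrite /flat_exp => ->. Qed.

Lemma flat_exp_gt0 n t : 0 < t -> 0 < flat_exp n t.
Proof.
by move=> t0; rewrite flat_exp_gt0E// mulr_gt0 ?expR_gt0// exprn_gt0 ?invr_gt0.
Qed.

Lemma flat_expS n t : flat_exp n t = flat_exp n.+1 t * t.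
Proof.
have [t0|t0] := ltP 0 t; last by rewrite !flat_exp_le0// mul0r.
by rewrite !flat_exp_gt0E// exprS [RHS]mulrC !mulrA mulfV ?gt_eqF// mul1r.
Qed.

(** With s = 1/t, the Taylor term s^(n+1)/(n+1)! is at most exp(s); rearranged, this is a bound
    linear in t, as the squeeze at 0 requires. *)
Lemma flat_exp_bound n t : 0 <= flat_exp n t <= n.+1`!%:R * `|t|.
Proof.
have [t0|t0] := ltP 0 t; last by rewrite flat_exp_le0// lexx mulr_ge0.
rewrite (ltW (flat_exp_gt0 _ _ t0)) flat_exp_gt0E// gtr0_norm//=.
have s0 : 0 < t^-1 by rewrite invr_gt0.
have f0 : 0 < n.+1`!%:R :> R by rewrite ltr0n fact_gt0.
have : t^-1 ^+ n.+1 / n.+1`!%:R <= expR t^-1.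
  by apply: (le_trans _ (expR_ge1Dxn n (ltW s0))); rewrite lerDr.
rewrite ler_pdivrMr// => H.
rewrite expRN ler_pdivrMr ?expR_gt0// mulrAC -ler_pdivrMr//.
by rewrite -exprSr [leRHS]mulrC.
Qed.

Lemma flat_exp_continuous0 n : {for 0, continuous (flat_exp n)}.
Proof.
rewrite /prop_for /continuous_at flat_exp_le0//.
apply: (@squeeze_cvgr _ _ _ _ (cst 0) (fun t => n.+1`!%:R * `|t|)).
- by near=> t; exact: flat_exp_bound.
- exact: cvg_cst.
- rewrite -[X in _ --> X](mulr0 n.+1`!%:R) -[X in _ * X](@normr0 _ R).
  by apply: cvgMr; apply: cvg_norm; exact: cvg_id.
Unshelve. all: by end_near. Qed.

(** The derivative is again a combination of members of the family, so first-order differentiability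
    for all [n] yields every order. *)
Lemma is_derive_flat_exp n x :
  is_derive x 1 (flat_exp n) (flat_exp n.+2 x - n%:R * flat_exp n.+1 x).
Proof.
have [x0|x0|->] := ltgtP x 0.
- rewrite !flat_exp_le0 ?ltW// mulr0 subr0.
  apply: (@near_eq_is_derive _ _ _ (cst 0)).
  by near=> y; rewrite flat_exp_le0// ltW//; near: y; exact: lt_nbhsl.
- apply: (@near_eq_is_derive _ _ _ (fun t => t^-1 ^+ n * expR (- t^-1))).
    by near=> y; rewrite flat_exp_gt0E//; near: y; exact: lt_nbhsr.
  have xV : is_derive x 1 (fun t : R => t^-1) (- x ^- 2).
    apply: is_derive_eq; first by apply: is_deriveV; rewrite gt_eqF.
    by rewrite scaler1.
  have xE : is_derive x 1 (fun t : R => expR (- t^-1)) (expR (- x^-1) * x ^- 2).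
    have := @is_derive1_comp _ _ (fun t : R => - t^-1) x _ _
      (is_derive_expR _) (is_deriveN xV).
    by rewrite opprK.
  have := is_deriveM (is_deriveX n xV) xE.
  rewrite exprfctE => H; apply: (is_derive_eq H).
  rewrite !flat_exp_gt0E// /GRing.scale/= -mulr_natl !exprVn.
  have xn0 : x != 0 by rewrite gt_eqF.
  (* The case [n = 0] is separate because the exponent [n.-1] of the power rule is truncated
     there. *)
  by case: n {H} => [|n]/=; rewrite !exprS; field; rewrite ?expf_neq0 ?xn0.
- (* g_n(t) = g_(n+1)(t) t, so differentiability at 0 reduces to continuity. *)
  rewrite !flat_exp_le0// mulr0 subr0.
  apply/is_derive1_caratheodory; exists (flat_exp n.+1); split.
  + by move=> t; rewrite [flat_exp n 0]flat_exp_le0// !subr0 flat_expS.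
  + exact: flat_exp_continuous0.
  + exact: flat_exp_le0.
Unshelve. all: by end_near. Qed.

End FlatExp.

(** * Smooth tensor-product bumps on R^d *)

Section Coordinate.
Context {R : realType} {d : nat}.
Implicit Types (f : scalar_field R d) (x : 'rV[R]_d).

(** A step k along axis j moves coordinate i by k if i = j and by 0 otherwise, so the difference
    quotient is that of [h] or identically 0. *)
Lemma is_derive_coord (h : R -> R) (i j : 'I_d) x (dh : R) :
  is_derive (x ord0 i) 1 h dh ->
  is_derive x (delta_mx ord0 j) (fun y : 'rV[R]_d => h (y ord0 i))
    (if i == j then dh else 0).
Proof.
move=> [hx hd].
suff quotientE : (fun k => k^-1 *: (((fun y : 'rV[R]_d => h (y ord0 i)) \o shift x)
        (k *: delta_mx ord0 j) - h (x ord0 i))) =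
    if i == j
    then fun k => k^-1 *: ((h \o shift (x ord0 i)) (k *: 1) - h (x ord0 i))
    else cst 0.
  split; rewrite /derivable /derive quotientE; case: eqP => // _.
    exact: is_cvg_cst.
  exact: lim_cst.
apply/funext => k /=; rewrite !mxE eqxx/=.
by case: eqP => //= _; rewrite mulr0 add0r subrr scaler0.
Qed.

(** Induction on the word. Derivability is proved at all points at once, since [pderivable] requires
    the lower orders on a whole neighbourhood. *)
Lemma pderiv_closed_class (K : set (scalar_field R d)) :
  (forall f i, K f ->
    exists2 g, K g & forall x, is_derive x (delta_mx ord0 i) f (g x)) ->
  forall f w, K f -> (forall x, pderivable w f x) /\ K (pderiv w f).
Proof.
move=> Kderive f w Kf; elim: w => [|i w [dw Kw]]; first by split.
have [g Kg dg] := Kderive _ i Kw.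
split=> [x|]; first by split; [exact: (@nearW _ (nbhs x) _ _ dw) | case: (dg x)].
rewrite (_ : pderiv (i :: w) f = g)//.
by apply/funext => x; case: (dg x).
Qed.

(* A class of continuous functions stable under partial derivatives, so that
   its members are smooth by induction on the order of differentiation. *)
Inductive bump_algebra : set (scalar_field R d) :=
| bump_cst (c : R) : bump_algebra (fun=> c)
| bump_coord n (a s : R) (i : 'I_d) :
    bump_algebra (fun x => flat_exp n (a + s * x ord0 i))
| bump_add f g : bump_algebra f -> bump_algebra g ->
    bump_algebra (fun x => f x + g x)
| bump_mul f g : bump_algebra f -> bump_algebra g ->
    bump_algebra (fun x => f x * g x).

Lemma bump_algebra_prod (I : Type) (r : seq I) (F : I -> scalar_field R d) :
  (forall i, bump_algebra (F i)) -> bump_algebra (fun x => \prod_(i <- r) F i x).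
Proof.
move=> KF; elim: r => [|i r IH].
  by under eq_fun do rewrite big_nil; exact: bump_cst.
by under eq_fun do rewrite big_cons; exact: bump_mul.
Qed.

Lemma bump_algebra_continuous f : bump_algebra f -> continuous f.
Proof.
elim=> {f} [c|n a s i|f g _ cf _ cg|f g _ cf _ cg] x.
- exact: cst_continuous.
- apply: (@continuous_comp _ _ _ (fun y : 'rV[R]_d => a + s * y ord0 i)
    (flat_exp n)).
    apply: continuousD; first exact: cst_continuous.
    by apply: continuousM; [exact: cst_continuous | exact: coord_continuous].
  apply/differentiable_continuous/derivable1_diffP.
  by case: (is_derive_flat_exp n (a + s * x ord0 i)).
- by apply: continuousD; [exact: cf | exact: cg].
- by apply: continuousM; [exact: cf | exact: cg].
Qed.

(** Differentiating a flat factor raises its index by one or two, which is why the generators allow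
    every [n]; sums and products follow from linearity and the Leibniz rule. *)
Lemma bump_algebra_derive f (i : 'I_d) : bump_algebra f ->
  exists2 g, bump_algebra g & forall x, is_derive x (delta_mx ord0 i) f (g x).
Proof.
elim=> {f} [c|n a s j|f g Kf [f' Kf' df] Kg [g' Kg' dg]|
            f g Kf [f' Kf' df] Kg [g' Kg' dg]].
- exists (fun=> 0); first exact: bump_cst.
  by move=> x; exact: is_derive_cst.
- exists (fun x => (if j == i then s else 0) *
      (flat_exp n.+2 (a + s * x ord0 j) -
       n%:R * flat_exp n.+1 (a + s * x ord0 j))).
    apply: bump_mul; first exact: bump_cst.
    apply: bump_add; first exact: bump_coord.
    under eq_fun do rewrite -mulNr.
    by apply: bump_mul; [exact: bump_cst|exact: bump_coord].
  move=> x.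
  have daff : is_derive (x ord0 j) 1 (fun t : R => a + s * t) s.
    have := is_deriveD (is_derive_cst a (x ord0 j) 1)
      (is_deriveZ s (is_derive_id (x ord0 j) 1)).
    by rewrite add0r /GRing.scale/= mulr1.
  have := is_derive_coord _ _ i _ _
    (@is_derive1_comp _ _ _ _ _ _ (is_derive_flat_exp n _) daff).
  by move=> H; apply: (is_derive_eq H); case: eqP; rewrite ?mul0r// mulrC.
- exists (fun x => f' x + g' x); first exact: bump_add.
  by move=> x; exact: is_deriveD (df x) (dg x).
- exists (fun x => f x * g' x + g x * f' x).
    by apply: bump_add; exact: bump_mul.
  by move=> x; exact: is_deriveM (df x) (dg x).
Qed.

Lemma exists_bump (x0 : 'rV[R]_d) (r : R) : 0 < r ->
  exists phi : scalar_field R d,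
    [/\ forall w x, pderivable w phi x,
        forall w, continuous (pderiv w phi),
        phi x0 = 1 &
        [set x | phi x != 0] `<=` ball x0 r].
Proof.
move=> r0.
(* The arguments are written as [a + s * x ord0 i] with s = 1 or -1 to match [bump_coord]. Both
   equal r at the centre, and both are positive exactly when x_i is within r of x0_i. *)
pose psi x := \prod_(i < d) (flat_exp 0 ((r - x0 ord0 i) + 1 * x ord0 i) *
                             flat_exp 0 ((r + x0 ord0 i) + (-1) * x ord0 i)).
have psi0 : psi x0 != 0.
  apply/prodf_neq0 => i _; rewrite mul1r mulN1r subrK addrK.
  by rewrite gt_eqF// mulr_gt0// flat_exp_gt0.
have Kphi : bump_algebra (fun x => (psi x0)^-1 * psi x).
  apply: bump_mul; first exact: bump_cst.
  by apply: bump_algebra_prod => i; apply: bump_mul; exact: bump_coord.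
have smooth w := pderiv_closed_class _ bump_algebra_derive _ w Kphi.
exists (fun x => (psi x0)^-1 * psi x); split.
- by move=> w; case: (smooth w).
- by move=> w; case: (smooth w) => _ /bump_algebra_continuous.
- by rewrite mulVf.
- move=> x /=; rewrite mulf_eq0 negb_or => /andP[_ /prodf_neq0 psix].
  split=> // i j; rewrite ord1; have := psix j isT.
  rewrite mulf_eq0 negb_or /ball/= => /andP[f1 f2].
  have t1 : 0 < r - x0 ord0 j + 1 * x ord0 j.
    by rewrite ltNge; apply: contra f1 => /flat_exp_le0 ->.
  have t2 : 0 < r + x0 ord0 j + -1 * x ord0 j.
    by rewrite ltNge; apply: contra f2 => /flat_exp_le0 ->.
  by rewrite ltr_distlC; apply/andP; split; lra.
Qed.

End Coordinate.

(** * Locality of sampled derivatives *)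

Section Locality.
Context {R : realType} {d : nat}.
Implicit Types (Omega : set 'rV[R]_d) (u v f : scalar_field R d).
Implicit Types (x z : 'rV[R]_d) (w : seq 'I_d) (alpha : multiindex d).

Lemma near_eq_pderiv w u v x : (\forall y \near x, u y = v y) ->
  \forall y \near x, pderiv w u y = pderiv w v y.
Proof.
(* A derivative at y depends on values around y, so [near_join] supplies agreement near each y close
   to x. *)
elim: w => [//|i w IH] /IH /near_join H; near=> y.
apply: near_eq_derive; near: y; exact: H.
Unshelve. all: by end_near. Qed.

Lemma near_eq_pderivable w u v x : (\forall y \near x, u y = v y) ->
  pderivable w u x -> pderivable w v x.
Proof.
elim: w x => [//|i w IH] x uv /= [du dwu]; split.
  move/near_join : uv => uv; near=> y; apply: IH; near: y => //.
exact: near_eq_derivable (near_eq_pderiv w _ _ _ uv) dwu.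
Unshelve. all: by end_near. Qed.

Lemma pderiv0 w x : pderiv w (fun=> 0) x = 0 :> R.
Proof.
elim: w x => [//|i w IH] x /=.
by rewrite (_ : pderiv w _ = cst 0) ?derive_cst//; apply/funext.
Qed.

Lemma near_eq_Dsample_filter Omega alpha u v z : (\forall y \near z, u y = v y) ->
  \forall y \near within Omega (nbhs z),
    pderiv (mword alpha) u y = pderiv (mword alpha) v y.
Proof. by move=> /(near_eq_pderiv (mword alpha)); exact: cvg_within. Qed.

Lemma near_eq_Dsample Omega alpha u v z : (\forall y \near z, u y = v y) ->
  Dsample Omega alpha u z = Dsample Omega alpha v z.
Proof.
move=> uv; rewrite /Dsample; case: ifP => _.
  exact: nbhs_singleton (near_eq_pderiv _ _ _ _ uv).
have W := near_eq_Dsample_filter Omega alpha _ _ _ uv.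
(* The two image filters are equal as sets, so the values of [lim] agree even where no limit exists
   and a default is returned. *)
congr (lim _); rewrite eqEsubset; split; apply: near_eq_cvg => //.
by apply: filterS W => y ->.
Qed.

Lemma near_eq_Dsample_defined Omega alpha u v z : (\forall y \near z, u y = v y) ->
  Dsample_defined Omega alpha u z -> Dsample_defined Omega alpha v z.
Proof.
move=> uv; rewrite /Dsample_defined; case: ifP => _.
  exact: near_eq_pderivable.
have W := near_eq_Dsample_filter Omega alpha _ _ _ uv.
move=> [du cu]; split.
  have /(cvg_within Omega) W' := near_join uv.
  by apply: filterS2 W' du => y; exact: near_eq_pderivable.
apply: cvgP; apply: cvg_trans cu; exact: near_eq_cvg.
Qed.

Lemma Dsample_near0 Omega alpha f z : closure Omega z ->
  (\forall y \near z, f y = 0) -> Dsample Omega alpha f z = 0.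
Proof.
move=> Oz /(near_eq_Dsample Omega alpha f (fun=> 0)) ->.
rewrite /Dsample (_ : pderiv _ _ = cst 0); last first.
  by apply/funext => x; exact: pderiv0.
(* At a point of the closure the trace filter on [Omega] is proper, so the limit of the zero
   function is determined. *)
by case: ifP => // _; have ? := within_nbhs_proper Oz; exact: lim_cst.
Qed.

End Locality.

(** * Perturbation by a bump and absence of certificates *)

Theorem proposition3p2 (R : realType) (d : nat) (Omega : set 'rV[R]_d)
    (hOmega : bounded_domain Omega)
    (m : nat) (z : 'I_m -> 'rV[R]_d) (hz : forall j, closure Omega (z j))
    (q : seq ('I_m * multiindex d))
    (loss : scalar_field R d -> R)
    (hloss : depends_only_on_samples Omega z q loss)
    (x0 : 'rV[R]_d) (hx0 : Omega x0) (hx0S : forall j, x0 <> z j) :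
  (exists phi : scalar_field R d,
    [/\ Cc_infty Omega phi,
        phi x0 = 1,
        forall (j : 'I_m) (alpha : multiindex d), used q alpha ->
          Dsample Omega alpha phi (z j) = 0 &
        forall (u : scalar_field R d) (beta : R), candidate Omega z q u ->
          [/\ candidate Omega z q (fun x => u x + beta * phi x),
              loss (fun x => u x + beta * phi x) = loss u &
              u x0 + beta * phi x0 = u x0 + beta]]) /\
  (forall (T : Type) (info : scalar_field R d -> T),
    depends_only_on_samples Omega z q info ->
    forall ustar : scalar_field R d, candidate Omega z q ustar ->
    forall I : interval R,
      certificate [set v | candidate Omega z q v /\ info v = info ustar] x0 I ->
      [set` I] = [set: R]).
Proof.
(* A closed ball is chosen because the support is a closure: the ball must contain it, lie in
   [Omega] and avoid the samples. *)
have [r r0 [rO rz]] : exists2 r, 0 < r & closed_ball x0 r `<=` Omega /\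
    forall j, ~ closed_ball x0 r (z j).
  have : nbhs x0 [set x | Omega x /\ forall j, x <> z j].
    apply: filterI; first by case: hOmega => Oo _ _ _; exact: open_nbhs_nbhs.
    apply: (@filter_forall _ _ (fun j x => x <> z j) (nbhs x0)) => j.
    apply: open_nbhs_nbhs; split; last exact: hx0S.
    have /closed_openC : closed [set z j]; last by [].
    exact/accessible_closed_set1/hausdorff_accessible/norm_hausdorff.
  move=> /nbhs_closedballP[r rOz]; exists r%:num => //.
  by split=> [x /rOz[]|j /rOz[_ /(_ j)]].
have [phi [dphi cphi phi1 phisupp]] := exists_bump x0 r r0.
have suppr : closure [set x | phi x != 0] `<=` closed_ball x0 r.
  exact: closure_subset.
(* Vanishing on a neighbourhood of each sample, and not only at it, handles all derivative orders
   together. *)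
have phi0 j : \forall y \near z j, phi y = 0.
  have : nbhs (z j) (~` closed_ball x0 r).
    apply: open_nbhs_nbhs; split; last exact: rz.
    exact/closed_openC/closed_ball_closed.
  apply: filterS => y yr; apply: contrapT => /eqP phiy.
  by apply: yr; apply: suppr; exact: subset_closure.
have perturb (u : scalar_field R d) (beta : R) j :
    \forall y \near z j, u y = u y + beta * phi y.
  by apply: filterS (phi0 j) => y ->; rewrite mulr0 addr0.
have cand u beta : candidate Omega z q u ->
    candidate Omega z q (fun x => u x + beta * phi x).
  by move=> cu j alpha /cu; exact: near_eq_Dsample_defined.
have same u beta : same_samples Omega z q (fun x => u x + beta * phi x) u.
  by move=> j alpha _; apply/esym; exact: near_eq_Dsample.
split.
  exists phi; split=> //.
  - split=> //; last exact: subset_trans suppr rO.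
    apply: bounded_closed_compact; last exact: closed_closure.
    case: hOmega => _ _ _ [M [realM OM]].
    by exists M; split=> // N /OM ON x /suppr/rO/ON.
  - by move=> j alpha _; exact: Dsample_near0.
  - move=> u beta cu; split; [exact: cand | | by rewrite phi1 mulr1].
    by apply: hloss => //; exact: cand.
move=> T info hinfo ustar custar I certI.
apply/seteqP; split=> // t _ /=.
(* The coefficient is chosen so that this indistinguishable candidate takes the arbitrary value [t]
   at [x0], which forces [t] into [I]. *)
have := certI (fun x => ustar x + (t - ustar x0) * phi x).
rewrite phi1 mulr1 subrKC; apply; split; first exact: cand.
by apply: hinfo => //; exact: cand.
Qed.
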